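(* Let $H$ be a complex Hilbert space with $\dim H=n<\infty$ and let $A$ be a positive invertible operator on $H$ with $\operatorname{Tr}(A)=1$. Let $\lambda_{\min}(A)$ be its smallest eigenvalue. Then $$\operatorname{OLC}(A)\le-\tfrac12\ln\lambda_{\min}(A).$$
   Context: For an invertible operator $A$, with $\|\cdot\|$ the operator norm, $\kappa(A):=\|A\|\,\|A^{-1}\|$ and $\operatorname{OLC}(A):=\tfrac12\ln\kappa(A)$. *)

(* Defs.v *)
From HB Require Import structures.
From mathcomp Require Import all_boot all_order all_algebra.
From mathcomp Require Import complex.
From mathcomp Require Import boolp classical_sets reals exp.

Set Implicit Arguments.
Unset Strict Implicit.
Unset Printing Implicit Defensive.

Import Order.TTheory GRing.Theory Num.Theory Num.Def.

Local Open Scope ring_scope.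
Local Open Scope classical_set_scope.

(* A complex Hilbert space of finite dimension is a vectType over R[i] with a
   positive definite Hermitian form; completeness is automatic.  The form is
   linear in its first argument and conjugate-linear in the second. *)

Section Operators.
Variables (R : realType) (H : vectType R[i]) (dot : {dot H for conjC}).
Implicit Types (A : 'End(H)) (v : H) (l : R).

(* [dot v v] is a nonnegative real, so taking [Re] only changes its type. *)
Definition hnorm v : R := Num.sqrt (complex.Re (dot v v)).

Definition opnorm A : R := sup [set hnorm (A v) | v in [set v | hnorm v <= 1]].

(* [A^-1] is the inverse of [A] only for bijective [A]. *)
Definition kappa A : R := opnorm A * opnorm A^-1%VF.

Definition OLC A : R := 2^-1 * ln (kappa A).

(* In R[i], [0 <= z] means that [z] is real and nonnegative. On a complex space
   this makes [A] self-adjoint, by polarization. *)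
Definition positive_operator A := forall v, 0 <= dot (A v) v.

Definition lftrace A : R[i] :=
  \tr (passmx.mxof (vbasis {:H}%VS) (vbasis {:H}%VS) A).

(* The eigenvalues are compared in R[i], so they are required to be real. *)
Definition smallest_eigenvalue A l :=
  passmx.leigenvalue A l%:C%C /\
  forall m : R[i], passmx.leigenvalue A m -> l%:C%C <= m.

(* The default value 0 is used only if there is no smallest eigenvalue. *)
Definition lambda_min A : R := xget 0 [set l | smallest_eigenvalue A l].

End Operators.

(* Main.v *)
(* In an orthonormal eigenbasis of A the eigenvalues are nonnegative and sum to
   Tr A = 1, so each lies between lambda_min A and 1.  Hence ||A|| <= 1 and
   ||A^-1|| <= 1 / lambda_min A, that is kappa A <= 1 / lambda_min A. *)

Require Import Defs.
From mathcomp Require Import all_boot all_order all_algebra.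
From mathcomp Require Import complex ring.
From mathcomp Require Import classical_sets reals exp.

Import Order.TTheory GRing.Theory Num.Theory Num.Def.
Local Open Scope ring_scope.

(** * Spectral theorem for positive operators *)

Lemma lfun_eigenvector {C : numClosedFieldType} {H : vectType C} (A : 'End(H)) :
  (0 < \dim {:H})%N -> exists a, passmx.leigenvalue A a.
Proof.
move=> H_gt0; have bH := vbasisP {:H}%VS.
have [a aP] := eigenvalue_closed (passmx.mxof (vbasis {:H}) (vbasis {:H}) A) H_gt0.
by exists a; rewrite /passmx.leigenvalue (passmx.leigenspaceE bH) passmx.vsof_eq0.
Qed.

Lemma leigenvalueP {F : fieldType} {H : vectType F} {A : 'End(H)} {a : F} :
  reflect (exists2 v, v != 0 & A v = a *: v) (passmx.leigenvalue A a).
Proof.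
have kerE v : (v \in passmx.leigenspace A a) = (A v == a *: v).
  by rewrite memv_ker !lfunE/= lfunE/= lfunE/= lfunE/= subr_eq0.
apply: (iffP idP) => [a_eig|[v v_neq0 Av]].
  exists (vpick (passmx.leigenspace A a)); first by rewrite vpick0.
  by apply/eqP; rewrite -kerE memv_pick.
by apply: contraNneq v_neq0 => a0; rewrite -memv0 -a0 kerE Av.
Qed.

Lemma stable_eigenvector {C : numClosedFieldType} {H : vectType C}
    (A : 'End(H)) (U : {vspace H}) :
  (A @: U <= U)%VS -> (0 < \dim U)%N ->
  exists v a, [/\ v \in U, v != 0 & A v = a *: v].
Proof.
move=> AU U_gt0.
(* The restriction of [A] to [U]; as [U] is stable, [vsproj U] changes only the type. *)
pose B : 'End(subvs_of U) := linfun (vsproj U \o A \o vsval).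
have dimU : \dim {: subvs_of U} = \dim U by rewrite dimvf /dim.
have [] := lfun_eigenvector B; first by rewrite dimU.
move=> a /leigenvalueP[w w_neq0 Bw]; exists (vsval w), a; split.
- exact: subvsP.
- by apply: contraNneq w_neq0 => w0; apply/eqP/val_inj.
- move/(congr1 vsval): Bw; rewrite lfunE/= vsprojK//.
  by apply: (subvP AU); rewrite memv_img ?subvsP.
Qed.

Lemma dot_eq0_sym {C : numClosedFieldType} {H : vectType C}
    {dot : {dot H for conjC}} {x w : H} : dot x w = 0 -> dot w x = 0.
Proof. by move=> xw; apply/eqP; rewrite herm_eq0C; apply/eqP. Qed.

(* This stands in for self-adjointness: were [z := dot (A x) w] nonzero, the
   real number [dot (A (x + 'i * z *: w)) (x + 'i * z *: w)] would have
   imaginary part [- `|z| ^+ 2]. *)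
Lemma positive_orthogonal_eigenvector {C : numClosedFieldType} {H : vectType C}
    (dot : {dot H for conjC}) (A : 'End(H)) (x w : H) (a : C) :
  (forall v, 0 <= dot (A v) v) -> A w = a *: w -> dot x w = 0 ->
  dot (A x) w = 0.
Proof.
move=> Apos Aw xw; set z := dot (A x) w.
have wx : dot w x = 0 := dot_eq0_sym xw.
have := Apos (x + ('i * z) *: w).
have -> : dot (A (x + ('i * z) *: w)) (x + ('i * z) *: w)
    = dot (A x) x + ('i * z)^* * z + `|'i * z| ^+ 2 * dot (A w) w.
  have -> : A (x + ('i * z) *: w) = A x + ('i * z) *: A w by rewrite linearD linearZ.
  rewrite linearDr/= linearZr_LR/= !linearDl/= !linearZl_LR/=.
  (* The other cross term vanishes: [A w] is a multiple of [w], which is orthogonal to [x]. *)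
  rewrite [dot (A w) x](_ : _ = 0) ?Aw ?linearZl_LR/= ?wx ?mulr0// addr0.
  by rewrite normCK -/z; ring.
move=> /ger0_real real_sum; apply/eqP; rewrite -normr_eq0 -sqrf_eq0 normCK.
have r1 : dot (A x) x \is Num.real by apply: ger0_real.
have r2 : `|'i * z| ^+ 2 * dot (A w) w \is Num.real.
  by apply: ger0_real; rewrite mulr_ge0 ?exprn_ge0.
have : ('i * z)^* * z \is Num.real.
  by move: real_sum; rewrite rpredDr // rpredDl.
rewrite rmorphM/= conjCi -mulrA mulNr [_^* * z]mulrC -normCK rpredN.
move=> /Creal_ImP; rewrite ImMil.
by move/Creal_ReP: (ger0_real (exprn_ge0 2 (normr_ge0 z))) => -> /eqP.
Qed.

(** Induction on [\dim U]: a nonzero stable [U] contains an eigenvector [w], and by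
    [positive_orthogonal_eigenvector] the orthogonal complement of [w] in [U] is again stable, one
    dimension lower. *)
Lemma positive_orthonormal_eigenseq {C : numClosedFieldType} {H : vectType C}
    (dot : {dot H for conjC}) (A : 'End(H)) (U : {vspace H}) :
  (forall v, 0 <= dot (A v) v) -> (A @: U <= U)%VS ->
  exists s : seq H, [/\ orthonormal dot s, size s = \dim U,
    {subset s <= U} & {in s, forall v, exists a, A v = a *: v}].
Proof.
move=> Apos; have [k] := ubnP (\dim U); elim: k U => // k IHk U Uk AU.
have [U0|U_gt0] := posnP (\dim U).
  by exists [::]; rewrite U0; split.
have [w [a [wU w0 Aw]]] := stable_eigenvector A U AU U_gt0.
have ww0 : dot w w != 0 by rewrite dnorm_eq0.
pose W := (U :&: orthov dot <[w]>)%VS.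
have dimW : (\dim U).-1 = \dim W.
  by apply: eq_dim_orthov1; apply/mem_orthovPn; exists w.
have AW : (A @: W <= W)%VS.
  apply/subvP => _ /memv_imgP[x + ->]; rewrite !memv_cap !mem_orthov1.
  move=> /andP[xU /eqP xw]; apply/andP; split.
    by rewrite (subvP AU)// memv_img.
  by apply/eqP/(positive_orthogonal_eigenvector dot A x w a).
have [] := IHk W _ AW; first by rewrite -dimW prednK.
move=> s [s_on s_size s_W s_eig].
pose u := (sqrtC (dot w w))^-1 *: w.
exists (u :: s); split.
- rewrite -cat1s orthonormal_cat s_on; apply/and3P; split => //.
    rewrite /orthonormal/= !andbT dnormZ normfV exprVn ger0_norm ?sqrtC_ge0 ?dnorm_ge0//.
    by rewrite sqrtCK mulVf.
  apply/orthoPl => x /s_W; rewrite memv_cap mem_orthov1 => /andP[_ /eqP xw].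
  by rewrite linearZl_LR/= (dot_eq0_sym xw) mulr0.
- by rewrite /= s_size -dimW prednK.
- move=> x; rewrite inE => /predU1P[->|/s_W]; first by rewrite rpredZ.
  by rewrite memv_cap => /andP[].
- move=> x; rewrite inE => /predU1P[->|/s_eig//].
  by exists a; rewrite linearZ/= Aw scalerA mulrC -scalerA.
Qed.

(** Both sides are traces of a product of the matrices of [A] and of the identity between the two
    bases, taken in opposite orders. *)
Lemma mxtrace_mxof {F : fieldType} {H : vectType F}
    (e f : (\dim {:H}).-tuple H) (A : 'End(H)) :
  basis_of {:H} e -> basis_of {:H} f ->
  \tr (passmx.mxof e e A) = \tr (passmx.mxof f f A).
Proof.
move=> eP fP; rewrite -[A in LHS]comp_lfun1r -[A in RHS]comp_lfun1l.
by rewrite (passmx.mxof_comp e e fP) (passmx.mxof_comp f f eP) mxtrace_mulC.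
Qed.

Lemma positive_eigenbasis {C : numClosedFieldType} {H : vectType C}
    (dot : {dot H for conjC}) (A : 'End(H)) :
  (forall v, 0 <= dot (A v) v) ->
  exists (e : (\dim {:H}).-tuple H) (a : 'I_(\dim {:H}) -> C),
    [/\ basis_of {:H} e, forall i j : 'I_(\dim {:H}), dot e`_i e`_j = (i == j)%:R,
        forall i : 'I_(\dim {:H}), A e`_i = a i *: e`_i & forall i, 0 <= a i].
Proof.
move=> Apos.
have [s [s_on s_size _ s_eig]] :=
  positive_orthonormal_eigenseq dot A {:H}%VS Apos (subvf _).
have [s_uniq s_dot] := orthonormalP s_on.
pose e : (\dim {:H}).-tuple H := tcast s_size (in_tuple s).
have eE : e = s :> seq H by rewrite /e val_tcast.
have e_mem (i : 'I_(\dim {:H})) : e`_i \in s by rewrite eE mem_nth ?s_size.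
(* A unit eigenvector [v] has eigenvalue [dot (A v) v]; in this form its nonnegativity is the
   positivity of [A]. *)
exists e, (fun i => dot (A e`_i) e`_i); split.
- rewrite basisEfree subvf size_tuple leqnn eE !andbT.
  exact: orthonormal_free s_on.
- by move=> i j; rewrite s_dot ?e_mem// eE nth_uniq ?s_size.
- move=> i; have [c Ac] := s_eig _ (e_mem i).
  by rewrite Ac linearZl_LR/= s_dot ?e_mem// eqxx mulr1.
- by move=> i; apply: Apos.
Qed.

(** * Operators in eigenbasis coordinates *)

Lemma dot_orthonormal_sum {C : numClosedFieldType} {H : vectType C}
    (dot : {dot H for conjC}) (n : nat) (e : 'I_n -> H) (x y : 'I_n -> C) :
  (forall i j, dot (e i) (e j) = (i == j)%:R) ->
  dot (\sum_i x i *: e i) (\sum_i y i *: e i) = \sum_i x i * (y i)^*.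
Proof.
move=> e_on; rewrite linear_sumlz; apply: eq_bigr => i _.
rewrite linearZl_LR/= linear_sumr (bigD1 i)//= linearZr_LR/= e_on eqxx mulr1.
rewrite big1 ?addr0// => j /negPf ji.
by rewrite linearZr_LR/= e_on eq_sym ji mulr0.
Qed.

Lemma lfun_eigenbasis_sum {F : fieldType} {H : vectType F}
    (e : (\dim {:H}).-tuple H) (b : 'I_(\dim {:H}) -> F) (B : 'End(H)) v :
  basis_of {:H} e -> (forall i : 'I_(\dim {:H}), B e`_i = b i *: e`_i) ->
  B v = \sum_i (coord e i v * b i) *: e`_i.
Proof.
move=> eP Be; rewrite [v in LHS](coord_basis eP) ?memvf// linear_sum.
by apply: eq_bigr => i _; rewrite linearZ/= Be scalerA.
Qed.

Lemma lftrace_eigenbasis {F : fieldType} {H : vectType F}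
    (e : (\dim {:H}).-tuple H) (b : 'I_(\dim {:H}) -> F) (B : 'End(H)) :
  basis_of {:H} e -> (forall i : 'I_(\dim {:H}), B e`_i = b i *: e`_i) ->
  \tr (passmx.mxof e e B) = \sum_i b i.
Proof.
move=> eP Be; apply: eq_bigr => i _.
rewrite !mxE/= passmx.vecof_delta Be linearZ/= coord_free ?(basis_free eP)//.
by rewrite eqxx mulr1.
Qed.

Lemma inv_lfun_eigenvector {F : fieldType} {H : vectType F} (A : 'End(H)) v a :
  injective A -> A v = a *: v -> A^-1%VF v = a^-1 *: v.
Proof.
move=> /lker0P A0 Av; have [a0|a_neq0] := eqVneq a 0; last first.
  by rewrite -{1}[v](scalerK a_neq0) linearZ/= -Av lker0_lfunK.
(* For [a = 0], injectivity forces [v = 0] and both sides vanish. *)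
have -> : v = 0 by move/lker0P: A0; apply; rewrite Av a0 scale0r linear0.
by rewrite linear0 scaler0.
Qed.

Section EigenbasisBounds.
Context {C : numClosedFieldType} {H : vectType C} (dot : {dot H for conjC}).
Context (e : (\dim {:H}).-tuple H) (b : 'I_(\dim {:H}) -> C) (B : 'End(H)).
Hypotheses (eP : basis_of {:H} e)
  (e_on : forall i j : 'I_(\dim {:H}), dot e`_i e`_j = (i == j)%:R)
  (Be : forall i : 'I_(\dim {:H}), B e`_i = b i *: e`_i).

Let dot_e x y := dot_orthonormal_sum dot _ (fun i : 'I_(\dim {:H}) => e`_i) x y e_on.
Let coord_e v := coord_basis eP (memvf v).

(** In orthonormal coordinates the squared norms of [B v] and [v] are the sums of |b_i v_i|^2 and of
    |v_i|^2, compared term by term. *)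
Lemma dot_eigenbasis_le (c : C) v : (forall i, `|b i| <= c) ->
  dot (B v) (B v) <= c ^+ 2 * dot v v.
Proof.
move=> bc; rewrite (lfun_eigenbasis_sum e b B v eP Be) dot_e.
rewrite [v in X in _ <= X]coord_e dot_e mulr_sumr; apply: ler_sum => i _.
rewrite -!normCK normrM exprMn mulrC ler_wpM2r ?exprn_ge0// lerXn2r ?nnegrE//.
exact: le_trans (bc i).
Qed.

(** For an eigenvector [v], [m * dot v v = dot (B v) v] is the sum of b_i |v_i|^2, hence at least
    [c * dot v v]; then divide by [dot v v > 0]. As the order is that of [C], this also shows that
    [m - c] is real. *)
Lemma leigenvalue_ge (c m : C) : (forall i, c <= b i) ->
  passmx.leigenvalue B m -> c <= m.
Proof.
move=> cb /leigenvalueP[v v0 Bv].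
have vv : 0 < dot v v by rewrite dnorm_gt0.
have dot_v (x : 'I_(\dim {:H}) -> C) :
    dot (\sum_i x i *: e`_i) v = \sum_i x i * (coord e i v)^*.
  by rewrite {1}[v]coord_e dot_e.
have Bvv : m * dot v v = \sum_i (coord e i v * b i) * (coord e i v)^*.
  by rewrite -dot_v -(lfun_eigenbasis_sum e b B v eP Be) Bv linearZl_LR.
rewrite -(ler_pM2r vv) Bvv {1}[v]coord_e dot_v mulr_sumr.
apply: ler_sum => i _; rewrite mulrAC -normCK [X in _ <= X]mulrC.
by rewrite ler_wpM2r ?exprn_ge0.
Qed.

End EigenbasisBounds.

(** * Operator norm and smallest eigenvalue *)

Lemma opnorm_ge0_le {R : realType} {H : vectType R[i]}
    (dot : {dot H for conjC}) (B : 'End(H)) (c : R) : 0 <= c ->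
  (forall v, dot (B v) (B v) <= c%:C%C ^+ 2 * dot v v) ->
  0 <= opnorm dot B <= c.
Proof.
move=> c0 Bc.
have Bv v : hnorm dot v <= 1 -> hnorm dot (B v) <= c.
  move=> v1; have : hnorm dot (B v) <= c * hnorm dot v.
    rewrite /hnorm -[c](ger0_norm c0) -sqrtr_sqr -sqrtrM ?sqr_ge0//.
    (* Taking real parts commutes with the factor [c ^+ 2], which is real. *)
    rewrite ler_wsqrtr//; have := Bc v; rewrite -rmorphXn/= lecE => /andP[_].
    by case: (dot v v) => x y /=; rewrite mul0r subr0.
  by move=> /le_trans; apply; rewrite ler_piMr.
have ubc : ubound [set hnorm dot (B v) | v in [set v | hnorm dot v <= 1]]%classic c.
  by move=> _ [v v1 <-]; apply: Bv.
(* The value at [v = 0] makes the set nonempty; bounded by [c], it has a true supremum, between 0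
   and [c]. *)
have B0 : [set hnorm dot (B v) | v in [set v | hnorm dot v <= 1]]%classic 0.
  by exists 0; rewrite /= ?linear0 /hnorm linear0l/= sqrtr0.
apply/andP; split; first by apply: ub_le_sup B0; exists c.
by apply: ge_sup ubc; exists 0.
Qed.

(** The least [r i] is an eigenvalue and, by [leigenvalue_ge], a lower bound for all of them, so
    [xget] does not fall back on its default. The index [i0] ensures that a least [r i] exists. *)
Lemma smallest_eigenvalue_lambda_min {R : realType} {H : vectType R[i]}
    (A : 'End(H)) (e : (\dim {:H}).-tuple H) (r : 'I_(\dim {:H}) -> R)
    (dot : {dot H for conjC}) (i0 : 'I_(\dim {:H})) :
  basis_of {:H} e ->
  (forall i j : 'I_(\dim {:H}), dot e`_i e`_j = (i == j)%:R) ->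
  (forall i : 'I_(\dim {:H}), A e`_i = (r i)%:C%C *: e`_i) ->
  smallest_eigenvalue A (lambda_min A).
Proof.
move=> eP e_on Ae; apply: xgetPex.
have [i _ ri] := @Order.TotalTheory.arg_minP _ R _ i0 xpredT r isT.
exists (r i); split.
  apply/leigenvalueP; exists e`_i; last exact: Ae.
  by rewrite -(dnorm_eq0 dot) e_on eqxx oner_eq0.
move=> m; apply: (leigenvalue_ge dot e _ A eP e_on Ae) => j.
by rewrite lecR ri.
Qed.

(** * From eigenvalue bounds to the condition number *)

Theorem mainTheorem10 (R : realType) (H : vectType R[i])
    (dot : {dot H for conjC}) (n : nat) (A : 'End(H)) :
  \dim {:H} = n ->
  positive_operator dot A ->
  bijective A ->
  lftrace A = 1 ->
  OLC dot A <= - 2^-1 * ln (lambda_min A).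
Proof.
move=> _ Apos /bij_inj A_inj trA.
have [e [a [eP e_on Ae a_ge0]]] := positive_eigenbasis dot A Apos.
pose r i := complex.Re (a i).
have aE i : a i = (r i)%:C%C by rewrite RRe_real// ger0_real.
have r_ge0 i : 0 <= r i by rewrite -lecR -aE.
have Ae' (i : 'I_(\dim {:H})) : A e`_i = (r i)%:C%C *: e`_i by rewrite Ae aE.
clearbody r.
(* [lftrace] is computed in [vbasis]; basis independence moves it to the eigenbasis. *)
have sum_r : \sum_i r i = 1.
  apply/complexI; rewrite rmorph_sum rmorph1 -trA /lftrace.
  rewrite (mxtrace_mxof _ e A (vbasisP _) eP).
  by rewrite (lftrace_eigenbasis e _ A eP Ae').
have r_le1 i : r i <= 1.
  by rewrite -sum_r (bigD1 i)//= lerDl sumr_ge0.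
(* In dimension 0 the sum in [sum_r] would be empty, hence 0. *)
have [i0 _|no_i] := pickP 'I_(\dim {:H}); last first.
  by move/eqP: sum_r; rewrite big_pred0// eq_sym oner_eq0.
have := smallest_eigenvalue_lambda_min A e r dot i0 eP e_on Ae'.
have [l <-] : exists l : R, l = lambda_min A by exists (lambda_min A).
move=> [l_eig l_min].
have e_neq0 (i : 'I_(\dim {:H})) : e`_i != 0.
  by rewrite -(dnorm_eq0 dot) e_on eqxx oner_eq0.
have l_le i : l <= r i.
  rewrite -lecR; apply: l_min; apply/leigenvalueP; exists e`_i.
    exact: e_neq0.
  exact: Ae'.
(* An eigenvector for the eigenvalue 0 would contradict the injectivity of [A]. *)
have l_gt0 : 0 < l.
  have [v v0 Av] := leigenvalueP l_eig.
  have l_ge0 : 0 <= l by rewrite -lecR (leigenvalue_ge dot e a A eP e_on Ae).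
  rewrite lt_def l_ge0 andbT.
  apply: contraNneq v0 => l0; apply/eqP/A_inj.
  by rewrite Av l0 scale0r linear0.
have r_gt0 i : 0 < r i by apply: lt_le_trans (l_le i).
have /andP[A_ge0 A_le1] : 0 <= opnorm dot A <= 1.
  apply: opnorm_ge0_le => // v.
  apply: (dot_eigenbasis_le dot e _ A eP e_on Ae') => i.
  by rewrite ger0_norm ?lecR.
(* The inverse is diagonal in the same eigenbasis, with eigenvalues [(r i)^-1]. *)
have /andP[V_ge0 V_le] : 0 <= opnorm dot A^-1%VF <= l^-1.
  apply: opnorm_ge0_le => [|v]; first by rewrite invr_ge0 ltW.
  apply: (dot_eigenbasis_le dot e (fun i => (r i)^-1%:C%C) A^-1%VF eP e_on).
    by move=> i; rewrite fmorphV; apply: inv_lfun_eigenvector.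
  move=> i; rewrite ger0_norm ?lecR ?invr_ge0//.
  by rewrite lef_pV2 ?posrE.
have kappa_le : kappa dot A <= l^-1.
  by rewrite -[l^-1]mul1r ler_pM.
rewrite /OLC mulNr -mulrN ler_pM2l ?invr_gt0// -lnV ?posrE//.
(* [ln] is monotone only on positive numbers and is 0 elsewhere; if [kappa dot A <= 0], the claim
   becomes [0 <= ln l^-1], which holds as [l <= r i0 <= 1]. *)
have [kappa_le0|kappa_gt0] := leP (kappa dot A) 0; last first.
  by rewrite ler_ln ?posrE ?invr_gt0.
by rewrite ln0// ln_ge0// invf_ge1// (le_trans (l_le i0)).
Qed.
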